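(* For every $\mathrm{S2S}+\forall^{\ast}_{\pi}$ formula $\phi$ one can effectively construct a semantically equivalent $\mathrm{S2S}$ formula $\psi$.
   Context: $\mathrm{S2S}$ is monadic second-order logic of the full binary tree $(\{\mathtt{L},\mathtt{R}\}^\ast,\mathrm{succ}_L,\mathrm{succ}_R)$ with $\mathrm{succ}_L=\{(w,w\mathtt{L})\}$, $\mathrm{succ}_R=\{(w,w\mathtt{R})\}$: formulas are built from atoms $\mathrm{succ}_L(x,y)$, $\mathrm{succ}_R(x,y)$, $x\in X$ using $\neg,\vee$, first-order quantification over vertices and second-order quantification over sets of vertices; a formula with free second-order variables $Y_1,\dots,Y_n$ defines the set of tuples of subsets of $\{\mathtt{L},\mathtt{R}\}^\ast$ satisfying it, and two formulas are semantically equivalent if they define the same set. A path is a set $X\subseteq\{\mathtt{L},\mathtt{R}\}^\ast$ containing the empty word, closed under prefixes, and such that each $v\in X$ has exactly one of $v\mathtt{L},v\mathtt{R}$ in $X$; the set $\mathcal{P}$ of paths is identified with $\{\mathtt{L},\mathtt{R}\}^\omega$ and given its product (Cantor) topology. $\mathrm{S2S}+\forall^{\ast}_{\pi}$ adds the quantifier $\forall^{\ast}_\pi X.\,\phi$: a tuple $t$ satisfies $\forall^{\ast}_\pi X.\,\phi(X,Y_1,\dots,Y_n)$ iff the set $\{p\in\mathcal{P}\mid (p,t)\text{ satisfies }\phi\}$ is comeager in $\mathcal{P}$. *)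

(* Defs.v *)
From HB Require Import structures.
From mathcomp Require Import all_boot.
From mathcomp Require Import boolp classical_sets functions topology cantor.

Set Implicit Arguments.
Unset Strict Implicit.
Unset Printing Implicit Defensive.

Local Open Scope classical_set_scope.

(* Words are read left to right: [false] is the letter L, [true] is R, and the
   children of [w] are [rcons w false] and [rcons w true]. *)
Definition vertex := seq bool.

Definition succL (v w : vertex) : Prop := w = rcons v false.
Definition succR (v w : vertex) : Prop := w = rcons v true.

Definition is_path (X : set vertex) : Prop :=
  [/\ X [::],
      (forall v w : vertex, prefix v w -> X w -> X v) &
      (forall v : vertex, X v ->
        (X (rcons v false) /\ ~ X (rcons v true)) \/
        (~ X (rcons v false) /\ X (rcons v true)))].

(* The identification of {L,R}^omega, with its product topology, with the set
   of paths: an omega-word is sent to the set of its finite prefixes. *)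
Definition path_of (a : cantor_space) : set vertex :=
  [set w | w = mkseq (a : nat -> bool) (size w)].

Definition nowhere_dense (T : topologicalType) (A : set T) : Prop :=
  interior (closure A) = set0.

Definition meager (T : topologicalType) (A : set T) : Prop :=
  exists N : nat -> set T,
    (forall n, nowhere_dense (N n)) /\ A = \bigcup_n N n.

Definition comeager (T : topologicalType) (A : set T) : Prop :=
  meager (~` A).

Definition comeager_paths (S : set (set vertex)) : Prop :=
  comeager (path_of @^-1` S).

(* First-order and second-order variables are two separate copies of [nat]. *)
Inductive formula : Type :=
| SuccL (x y : nat)
| SuccR (x y : nat)
| Mem (x X : nat)
| Neg (phi : formula)
| Or (phi psi : formula)
| Forall1 (x : nat) (phi : formula)
| Exists1 (x : nat) (phi : formula)
| Forall2 (X : nat) (phi : formula)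
| Exists2 (X : nat) (phi : formula)
| ForallStar (X : nat) (phi : formula).

(* [formula] is the syntax of S2S + forall*_pi; S2S is the fragment without
   [ForallStar]. *)
Fixpoint is_S2S (phi : formula) : bool :=
  match phi with
  | SuccL _ _ | SuccR _ _ | Mem _ _ => true
  | Neg p | Forall1 _ p | Exists1 _ p | Forall2 _ p | Exists2 _ p => is_S2S p
  | Or p q => is_S2S p && is_S2S q
  | ForallStar _ _ => false
  end.

Fixpoint free1 (phi : formula) : seq nat :=
  match phi with
  | SuccL x y | SuccR x y => [:: x; y]
  | Mem x _ => [:: x]
  | Neg p | Forall2 _ p | Exists2 _ p | ForallStar _ p => free1 p
  | Or p q => free1 p ++ free1 q
  | Forall1 x p | Exists1 x p => [seq z <- free1 p | z != x]
  end.

Fixpoint free2 (phi : formula) : seq nat :=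
  match phi with
  | SuccL _ _ | SuccR _ _ => [::]
  | Mem _ X => [:: X]
  | Neg p | Forall1 _ p | Exists1 _ p => free2 p
  | Or p q => free2 p ++ free2 q
  | Forall2 X p | Exists2 X p | ForallStar X p => [seq Z <- free2 p | Z != X]
  end.

Definition update (T : Type) (e : nat -> T) (x : nat) (a : T) : nat -> T :=
  fun z => if z == x then a else e z.

Fixpoint sat (e1 : nat -> vertex) (e2 : nat -> set vertex) (phi : formula)
    : Prop :=
  match phi with
  | SuccL x y => succL (e1 x) (e1 y)
  | SuccR x y => succR (e1 x) (e1 y)
  | Mem x X => e2 X (e1 x)
  | Neg p => ~ sat e1 e2 p
  | Or p q => sat e1 e2 p \/ sat e1 e2 q
  | Forall1 x p => forall v : vertex, sat (update e1 x v) e2 p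
  | Exists1 x p => exists v : vertex, sat (update e1 x v) e2 p
  | Forall2 X p => forall A : set vertex, sat e1 (update e2 X A) p
  | Exists2 X p => exists A : set vertex, sat e1 (update e2 X A) p
  | ForallStar X p =>
      comeager_paths [set A | is_path A /\ sat e1 (update e2 X A) p]
  end.

(* [phi] is a formula phi(x_1,...,x_m,Y_1,...,Y_n) in the listed variables;
   [xs = [::]] is the case where only set variables are free. *)
Definition formula_in (xs Ys : seq nat) (phi : formula) : bool :=
  [&& uniq xs, uniq Ys, all (mem xs) (free1 phi) & all (mem Ys) (free2 phi)].

(* The set of tuples satisfying phi(x_1,...,x_m,Y_1,...,Y_n). The default
   values of [nth] are irrelevant when [formula_in xs Ys phi] holds. *)
Definition defined_set (xs Ys : seq nat) (phi : formula)
    : set ((size xs).-tuple vertex * (size Ys).-tuple (set vertex)) :=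
  [set t : (size xs).-tuple vertex * (size Ys).-tuple (set vertex) |
           sat (fun x => nth [::] t.1 (index x xs))
               (fun Y => nth set0 t.2 (index Y Ys)) phi].
Arguments defined_set : clear implicits.

(* Kleene's partial recursive functions. *)
Inductive murec : Type :=
| MZero
| MSucc
| MProj (i : nat)
| MComp (f : murec) (gs : seq murec)
| MRec (f g : murec)
| MMin (f : murec).

Inductive eval : murec -> seq nat -> nat -> Prop :=
| eval_zero xs : eval MZero xs 0
| eval_succ x xs : eval MSucc (x :: xs) x.+1
| eval_proj i xs : i < size xs -> eval (MProj i) xs (nth 0 xs i)
| eval_comp f gs xs ys z :
    size ys = size gs ->
    (forall i, i < size gs -> eval (nth MZero gs i) xs (nth 0 ys i)) ->
    eval f ys z -> eval (MComp f gs) xs z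
| eval_rec0 f g xs z :
    eval f xs z -> eval (MRec f g) (0 :: xs) z
| eval_recS f g k xs y z :
    eval (MRec f g) (k :: xs) y -> eval g (k :: y :: xs) z ->
    eval (MRec f g) (k.+1 :: xs) z
| eval_min f xs n (w : nat -> nat) :
    eval f (n :: xs) 0 ->
    (forall k, k < n -> eval f (k :: xs) (w k).+1) ->
    eval (MMin f) xs n.

(* Cantor's pairing function. *)
Definition cpair (x y : nat) : nat := 'C((x + y).+1, 2) + y.

(* Goedel numbering of formulas. *)
Fixpoint code (phi : formula) : nat :=
  match phi with
  | SuccL x y => cpair 0 (cpair x y)
  | SuccR x y => cpair 1 (cpair x y)
  | Mem x X => cpair 2 (cpair x X)
  | Neg p => cpair 3 (code p)
  | Or p q => cpair 4 (cpair (code p) (code q))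
  | Forall1 x p => cpair 5 (cpair x (code p))
  | Exists1 x p => cpair 6 (cpair x (code p))
  | Forall2 X p => cpair 7 (cpair X (code p))
  | Exists2 X p => cpair 8 (cpair X (code p))
  | ForallStar X p => cpair 9 (cpair X (code p))
  end.

Definition effective (F : formula -> formula) : Prop :=
  exists c : murec, forall phi : formula, eval c [:: code phi] (code (F phi)).

Lemma path_of_is_path (a : cantor_space) : is_path (path_of a).
Proof.
have nthP (w : vertex) : path_of a w <->
    forall i, i < size w -> nth false w i = (a : nat -> bool) i.
  split=> [-> i|H].
    by rewrite size_mkseq => ?; rewrite nth_mkseq.
  apply: (@eq_from_nth _ false); first by rewrite size_mkseq.
  by move=> i iw; rewrite nth_mkseq // H.
have step (v : vertex) b : path_of a v ->
    path_of a (rcons v b) <-> b = (a : nat -> bool) (size v).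
  move=> /nthP H; split=> [/nthP/(_ (size v))|E].
    by rewrite size_rcons ltnSn nth_rcons ltnn eqxx => /(_ isT).
  apply/nthP => i; rewrite size_rcons ltnS leq_eqVlt nth_rcons.
  case/orP=> [/eqP->|iv]; first by rewrite ltnn eqxx.
  by rewrite iv H.
split=> //.
- move=> v w /prefixP[u ->] /nthP H; apply/nthP => i iv.
  by rewrite -H ?size_cat ?ltn_addr // nth_cat iv.
- move=> v Xv; case E: ((a : nat -> bool) (size v)).
    right; split; last by apply/step.
    by move/(step _ _ Xv); rewrite E.
  left; split; first by apply/step.
  by move/(step _ _ Xv); rewrite E.
Qed.

Lemma path_of_inj : injective path_of.
Proof.
move=> a b ab; apply: funext => n.
have : path_of a (mkseq (a : nat -> bool) n.+1) by rewrite /path_of /mkset size_mkseq.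
rewrite ab /path_of /mkset size_mkseq => /(congr1 (fun s => nth false s n)).
by rewrite !nth_mkseq.
Qed.

Lemma path_of_surj (X : set vertex) :
  is_path X -> exists a : cantor_space, path_of a = X.
Proof.
case=> X0 Xpre Xstep.
pose g := fix g n : vertex :=
  if n is m.+1 then rcons (g m) `[< X (rcons (g m) true) >] else [::].
have Xg n : X (g n).
  elim: n => //= n IH; case: (Xstep _ IH) => -[] p q.
    by rewrite (asboolF q).
  by rewrite (asboolT q).
pose a : nat -> bool := fun n => `[< X (rcons (g n) true) >].
have ga n : mkseq a n = g n.
  by elim: n => //= n IH; rewrite mkseqS IH.
exists (a : cantor_space); rewrite eqEsubset; split=> w.
  by rewrite /path_of /mkset => ->; rewrite ga.
elim/last_ind: w => // w b IH Xwb.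
have Xw : X w by apply: Xpre Xwb; rewrite prefix_rcons.
have wE : w = g (size w) by rewrite -ga; exact: IH.
rewrite /path_of /mkset size_rcons mkseqS -(IH Xw) /a -wE.
congr rcons; case: (Xstep _ Xw) => -[] p q.
  by rewrite (asboolF q); case: b Xwb => // /q.
by rewrite (asboolT q); case: b Xwb => // /p.
Qed.

Lemma eval_det c xs y z : eval c xs y -> eval c xs z -> y = z.
Proof.
move=> E; elim: E z => {c xs y}.
- by move=> xs z E; inversion E.
- by move=> x xs z E; inversion E.
- by move=> i xs _ z E; inversion E.
- move=> f gs xs ys z sz _ IHg _ IHf z' E; inversion E; subst.
  apply: IHf; suff -> : ys = ys0 by [].
  apply: (@eq_from_nth _ 0); first by rewrite sz.
  by move=> i; rewrite sz => ig; apply: IHg => //; auto.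
- by move=> f g xs z _ IH z' E; inversion E; subst; apply: IH.
- move=> f g k xs y z _ IH1 _ IH2 z' E; inversion E; subst.
  apply: IH2; suff -> : y = y0 by [].
  exact: IH1.
- move=> f xs n w _ IH0 _ IHk z' E; inversion E; subst.
  case: (ltngtP n z') => // lt.
    by match goal with H : forall k, _ -> eval _ _ (_ k).+1 |- _ =>
      by have := IH0 _ (H _ lt) end.
  by match goal with H : eval f (z' :: xs) 0 |- _ =>
    by have := IHk _ lt _ H end.
Qed.

Lemma cpair_inj x y x' y' : cpair x y = cpair x' y' -> x = x' /\ y = y'.
Proof.
have lt u v u' v' : u + v < u' + v' -> cpair u v < cpair u' v'.
  move=> H; rewrite /cpair; apply: (@leq_trans 'C((u' + v').+1, 2)); last exact: leq_addr.
  apply: (@leq_trans 'C((u + v).+2, 2)); last exact: leq_bin2l.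
  by rewrite [X in _ < X]binS bin1 ltn_add2l ltnS leq_addl.
move=> E; case: (ltngtP (x + y) (x' + y')) => [/lt|/lt|S].
- by rewrite E ltnn.
- by rewrite E ltnn.
- move: E; rewrite /cpair S => /addnI Ey; split=> //.
  by move: S; rewrite Ey => /addIn.
Qed.

Lemma code_inj : injective code.
Proof.
elim=> [x y|x y|x X|p IH|p IHp q IHq|x p IH|x p IH|X p IH|X p IH|X p IH] [] /= *;
  repeat match goal with H : cpair _ _ = cpair _ _ |- _ =>
    case/cpair_inj: H => ? ? end;
  by subst => //; f_equal; auto.
Qed.

(* Main.v *)
(* A set of branches of the binary tree is comeager iff it contains a dense
   G_delta set, and the dense G_delta sets are, up to shrinking, the sets of
   branches that meet infinitely often a set D of vertices in which every vertex
   has a descendant. As S2S quantifies over sets of vertices, forall*_pi X. phi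
   is thus equivalent to "there is such a D for which every path X meeting D
   infinitely often satisfies phi", for arbitrary phi and without automata. The
   translation acts on Goedel numbers by course-of-values recursion. *)
Require Import Defs.
From mathcomp Require Import all_boot.
From mathcomp Require Import boolp classical_sets functions topology cantor.

(* [all_boot] and [topology] shadow [Mem] and [eval]. *)
Import Defs.

Set Implicit Arguments.
Unset Strict Implicit.
Unset Printing Implicit Defensive.

Local Open Scope classical_set_scope.

Arguments cpair : simpl never.

(** * Comeager sets of paths *)

Definition cylinder (v : vertex) : set cantor_space :=
  [set a | path_of a v].

Lemma mkseq_prefix (T : eqType) (f : nat -> T) m n :
  m <= n -> prefix (mkseq f m) (mkseq f n).
Proof.
move=> /subnKC <-; apply/prefixP; exists (mkseq (fun i => f (m + i)) (n - m)).
rewrite /mkseq iotaD map_cat; congr (_ ++ _).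
by rewrite add0n -[X in iota X]addn0 iotaDl -map_comp.
Qed.

Lemma path_of_mkseq (a : cantor_space) n : path_of a (mkseq (a : nat -> bool) n).
Proof. by rewrite /path_of /= size_mkseq. Qed.

Lemma cylinder_mkseq (a b : cantor_space) n :
  cylinder (mkseq (a : nat -> bool) n) b <->
  mkseq (b : nat -> bool) n = mkseq (a : nat -> bool) n.
Proof. by rewrite /cylinder /path_of /= size_mkseq; split=> ->. Qed.

Lemma cylinder_prefix u v : prefix u v -> cylinder v `<=` cylinder u.
Proof. by move=> uv a; have [_ + _] := path_of_is_path a; apply; eassumption. Qed.

Lemma cylinder_comparable a u v : cylinder u a -> cylinder v a ->
  size u <= size v -> prefix u v.
Proof. by move=> -> ->; rewrite !size_mkseq; apply: mkseq_prefix. Qed.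

Lemma cylinder_neq0 v : cylinder v !=set0.
Proof.
(* The default value of [nth] continues [v] with the letter L forever. *)
exists (nth false v : cantor_space); rewrite /cylinder/= /path_of/=.
by rewrite mkseq_nth.
Qed.

(** A cylinder constrains finitely many letters, and each coordinate projection is continuous into
    the discrete space [bool]. *)
Lemma nbhs_cylinder (a : cantor_space) v : cylinder v a -> nbhs a (cylinder v).
Proof.
rewrite {1}/cylinder /path_of /= => ->; move: (size v) => n.
suff : nbhs a [set b : cantor_space |
    mkseq (b : nat -> bool) n = mkseq (a : nat -> bool) n].
  by apply: filterS => b /= ?; apply/cylinder_mkseq.
elim: n => [|n IH]; first exact: filterS filterT.
have := @proj_continuous nat (fun=> bool) n a _ (discrete_set1 _).
apply: filterS2 IH => b /= ba bna; rewrite !mkseqS ba; congr rcons.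
exact: bna.
Qed.

(** The product topology is the supremum of the topologies induced by the coordinates, so it is
    enough that the filter generated by the cylinders around [a] converges to [a] in each
    coordinate. *)
Lemma nbhs_cantorP (a : cantor_space) (A : set cantor_space) :
  nbhs a A -> exists n, cylinder (mkseq (a : nat -> bool) n) `<=` A.
Proof.
pose F := filter_from [set: nat] (fun n => cylinder (mkseq (a : nat -> bool) n)).
suff /[apply] : F --> a by case=> n _ ?; exists n.
have FF : Filter F.
  apply: filter_from_filter; first by exists 0.
  move=> i j _ _; exists (maxn i j) => //; rewrite subsetI.
  by split; apply: cylinder_prefix; apply: mkseq_prefix;
    rewrite (leq_maxl, leq_maxr).
apply/cvg_sup => i; apply/cvg_image.
  by rewrite eqEsubset; split=> // b _; exists (fun=> b).
move=> U /nbhs_singleton Uai; exists [set f : cantor_space | U (f i)].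
  (* Letter [i] is the last letter of the prefix of length [i.+1]. *)
  exists i.+1 => // b /cylinder_mkseq; rewrite !mkseqS.
  by move=> /rcons_inj[_ /= ->].
rewrite eqEsubset; split=> [c [f Uf <-]//|c Uc].
by exists (fun=> c).
Qed.

Lemma nowhere_dense_cylinderP (A : set cantor_space) :
  nowhere_dense A <->
  forall v, exists2 w, prefix v w & cylinder w `&` A = set0.
Proof.
split=> [A0 v|H].
  apply: contrapT => /forall2NP H.
  have [a va] := cylinder_neq0 v.
  suff : interior (closure A) a by rewrite A0.
  apply: filterS (nbhs_cylinder va).
  move=> b vb B /nbhs_cantorP[n nB].
  (* This length makes [w] extend [v] and keeps its cylinder inside the given neighbourhood [B] of
     [b]. *)
  set w := mkseq (b : nat -> bool) (maxn n (size v)).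
  have [/negP|] := H w.
    case/negP; apply: cylinder_comparable vb _ _; first exact: path_of_mkseq.
    by rewrite size_mkseq leq_maxr.
  move=> /eqP/set0P[c [wc Ac]]; exists c; split=> //; apply: nB.
  by apply: cylinder_prefix wc; apply/mkseq_prefix/leq_maxl.
rewrite /nowhere_dense -subset0 => a /nbhs_cantorP[n nA].
have [w vw wA0] := H (mkseq (a : nat -> bool) n).
have [c wc] := cylinder_neq0 w.
have [d [Ad wd]] := nA _ (cylinder_prefix vw wc) _ (nbhs_cylinder wc).
by suff : set0 d by []; rewrite -wA0.
Qed.

Definition prefix_dense (D : set vertex) : Prop :=
  forall v, exists2 w, prefix v w & D w.

(** On a path, infinitude is cofinality; this form needs no counting and translates directly into
    first-order quantifiers. *)
Definition meets_infinitely_often (X D : set vertex) : Prop :=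
  forall v, X v -> exists2 w, prefix v w & X w /\ D w.

(** The finite part of the Baire category argument: the word is extended once for each of the first
    [n] sets. *)
Lemma meager_avoid (N : nat -> set cantor_space) n v :
  (forall i, nowhere_dense (N i)) ->
  exists2 w, prefix v w & forall i, i < n -> cylinder w `&` N i = set0.
Proof.
move=> N0; elim: n => [|n [u vu uN]]; first by exists v => //; exact: prefix_refl.
have /nowhere_dense_cylinderP/(_ u)[w uw wN] := N0 n.
exists w => [|i]; first exact: prefix_trans uw.
rewrite ltnS leq_eqVlt => /predU1P[->//|/uN uNi].
by rewrite -subset0 -uNi; apply: setSI; exact: cylinder_prefix uw.
Qed.

Lemma comeager_pathsP (S : set (set vertex)) :
  comeager_paths S <->
  exists2 D, prefix_dense D &
    forall X, is_path X -> meets_infinitely_often X D -> S X.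
Proof.
split=> [[N [N0 NE]]|[D Dd DS]]; last first.
  (* [meager] asks for an equality with the union, hence the intersection with the complement of
     [S]. The second factor collects the branches that avoid [D] from depth [n] on. *)
  pose N n := ~` (path_of @^-1` S) `&`
    [set a | forall w, n <= size w -> D w -> ~ path_of a w].
  exists N; split=> [n|].
    apply/nowhere_dense_cylinderP => v.
    (* Padding by [n] letters forces the word found in [D] to have length at least [n]. *)
    have [w vw Dw] := Dd (v ++ nseq n false); exists w.
      exact: prefix_trans (prefix_prefix _ _) vw.
    rewrite -subset0 => a [wa [_ /(_ w) nD]]; apply: nD => //.
    apply: leq_trans (size_prefix vw).
    by rewrite size_cat size_nseq leq_addl.
  rewrite eqEsubset; split=> [a Sa|a [n _ []]//].
  apply: contrapT => aN; apply: (Sa); apply: DS; first exact: path_of_is_path.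
  move=> v av; apply: contrapT => nD; apply: aN.
  exists (size v) => //; split=> // w vw Dw aw; apply: nD; exists w => //.
  exact: cylinder_comparable av aw vw.
(* For each [n] the words minimal for [P n] form an antichain, so a branch
   meeting [D] infinitely often meets it for unboundedly many [n], and hence
   avoids every [N i]. *)
pose P n w := n <= size w /\ forall i, i < n -> cylinder w `&` N i = set0.
pose Pmin n w := P n w /\ forall u, prefix u w -> P n u -> u = w.
exists [set w | exists n, Pmin n w].
  move=> v; have [u vu uN] := meager_avoid (size v) v N0.
  have exk : exists k, `[< P (size v) (take k u) >].
    exists (size u); apply/asboolP; rewrite take_size; split=> //.
    exact: size_prefix.
  case: (ex_minnP exk) => k /asboolP Pk kmin.
  (* The length condition in [P], taken at [size v], keeps the shortest suitable prefix of [u] from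
     falling short of [v]. *)
  have vku : prefix v (take k u).
    have [c kc] := cylinder_neq0 u.
    apply: (@cylinder_comparable c); last by case: Pk.
      exact: cylinder_prefix vu _ kc.
    exact: cylinder_prefix (prefix_take _ _) _ kc.
  exists (take k u) => //; exists (size v); split=> // x xk Px.
  have xk' : size x <= k.
    by apply: leq_trans (size_prefix xk) _; rewrite size_take_min geq_minl.
  have xE : x = take (size x) u.
    by apply/esym/eqP; rewrite -prefixE; apply: prefix_trans xk (prefix_take _ _).
  have /kmin kx : `[< P (size v) (take (size x) u) >] by apply/asboolP; rewrite -xE.
  by rewrite xE; congr take; apply/eqP; rewrite eqn_leq xk'.
move=> X /path_of_surj[a <-] aD; apply: contrapT => nSa.
have [i _ Nia] : (\bigcup_n N n) a by rewrite -NE.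
have bound m : exists L, forall n w, n < m -> Pmin n w -> path_of a w ->
    size w <= L.
  elim: m => [|m [L HL]]; first by exists 0.
  case: (pselect (exists2 w, Pmin m w & path_of a w)) => [[w [Pw wmin] aw]|nw].
    exists (maxn L (size w)) => n u; rewrite ltnS leq_eqVlt leq_max.
    case/predU1P=> [->|nm]; last by move=> uP au; rewrite (HL n).
    move=> [Pu umin] au; case/orP: (leq_total (size w) (size u)) => wu.
      by rewrite (umin w) ?leqnn ?orbT //; exact: cylinder_comparable aw au _.
    by rewrite wu orbT.
  exists L => n u; rewrite ltnS leq_eqVlt => /predU1P[->|]; last exact: HL.
  by move=> uP au; case: nw; exists u.
have [L HL] := bound i.+1.
(* Beyond depth [L] the branch can meet [D] only in words minimal for some [n > i], and the cylinder
   of such a word misses [N i]. *)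
have [w vw [aw [n Pnw]]] := aD _ (path_of_mkseq a L.+1).
have := size_prefix vw; rewrite size_mkseq ltnNge (HL n) //.
rewrite ltnS leqNgt; apply/negP => ni.
have [[_ /(_ _ ni) wN0] _] := Pnw.
suff : (cylinder w `&` N i) a by rewrite wN0.
by split.
Qed.

(** * Eliminating the category quantifier *)

Lemma leq_cpairl x y : x <= cpair x y.
Proof.
apply: leq_trans (leq_addr y _); rewrite binS bin1.
by rewrite (leq_trans (leq_addr y x)) // leq_addl.
Qed.

Lemma leq_cpairr x y : y <= cpair x y.
Proof. exact: leq_addl. Qed.

(** Compound formulas have positive tags, so subformulas get strictly smaller codes and
    course-of-values recursion can reach them. *)
Lemma ltn_cpairr x y : 0 < x -> y < cpair x y.
Proof.
move=> x0; rewrite /cpair -[X in X < _]add0n ltn_add2r bin_gt0.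
by rewrite ltnS addn_gt0 x0.
Qed.

(** Any number above the code is thus a fresh set variable, obtained arithmetically from the code
    alone. *)
Lemma free2_leq_code phi Z : Z \in free2 phi -> Z <= code phi.
Proof.
elim: phi => [x y|x y|x X|p IH|p IHp q IHq|x p IH|x p IH|X p IH|X p IH|X p IH] //=.
- rewrite inE => /eqP->.
  exact: leq_trans (leq_cpairr _ _) (leq_cpairr _ _).
- by move/IH => /leq_trans; apply; exact: leq_cpairr.
- rewrite mem_cat => /orP[/IHp|/IHq] /leq_trans; apply;
    apply: leq_trans (leq_cpairr _ _); [exact: leq_cpairl|exact: leq_cpairr].
- move=> /IH /leq_trans; apply.
  exact: leq_trans (leq_cpairr _ _) (leq_cpairr _ _).
- move=> /IH /leq_trans; apply.
  exact: leq_trans (leq_cpairr _ _) (leq_cpairr _ _).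
all: rewrite mem_filter => /andP[_ /IH] /leq_trans; apply.
all: exact: leq_trans (leq_cpairr _ _) (leq_cpairr _ _).
Qed.

Lemma update_eq (T : Type) (e : nat -> T) x a : update e x a x = a.
Proof. by rewrite /update eqxx. Qed.

Lemma update_neq (T : Type) (e : nat -> T) x y a : y != x -> update e x a y = e y.
Proof. by rewrite /update => /negbTE->. Qed.

(** An equality of propositions, rather than an equivalence, lets the induction pass under
    [comeager_paths]. *)
Lemma sat_free2 phi e1 (e2 e2' : nat -> set vertex) :
  {in free2 phi, e2 =1 e2'} -> sat e1 e2 phi = sat e1 e2' phi.
Proof.
have under_binder X (p : formula) A (f f' : nat -> set vertex) :
    {in [seq Z <- free2 p | Z != X], f =1 f'} ->
    {in free2 p, update f X A =1 update f' X A}.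
  move=> H Z pZ; rewrite /update; case: eqP => // /eqP ZX.
  by apply: H; rewrite mem_filter ZX.
elim: phi e1 e2 e2' => [x y|x y|x X|p IH|p IHp q IHq|x p IH|x p IH|X p IH|X p IH|X p IH]
  e1 e2 e2' //= H.
- by rewrite H // mem_head.
- by rewrite (IH _ _ _ H).
- by rewrite (IHp _ e2 e2') ?(IHq _ e2 e2') // => Z Zp; apply: H;
    rewrite mem_cat Zp ?orbT.
- by apply: eq_forall => v; exact: IH.
- by apply: eq_exists => v; exact: IH.
- by apply: eq_forall => A; apply/IH/under_binder.
- by apply: eq_exists => A; apply/IH/under_binder.
- congr comeager_paths; apply: eq_set => A; congr (_ /\ _).
  exact/IH/under_binder.
Qed.

(** * S2S formulas for prefixes, density and paths *)

Definition And p q := Neg (Or (Neg p) (Neg q)).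
Definition Imp p q := Or (Neg p) q.
Definition Succ x y := Or (SuccL x y) (SuccR x y).

Lemma iff_imply P Q : ~ P \/ Q <-> (P -> Q).
Proof. by rewrite implyE. Qed.

Lemma iff_and P Q : ~ (~ P \/ ~ Q) <-> P /\ Q.
Proof. by rewrite not_orE !notK. Qed.

Lemma iff_succ v w : succL v w \/ succR v w <-> exists b, w = rcons v b.
Proof.
split=> [[->|->]|[[] ->]]; [by exists false|by exists true|by right|by left].
Qed.

(* Vertex 0 is a prefix of vertex 1: every set closed under successors that
   contains the former contains the latter. *)
Definition Prefix A :=
  Forall2 A (Imp (Mem 0 A)
    (Imp (Forall1 2 (Forall1 3
           (Imp (Mem 2 A) (Imp (Succ 2 3) (Mem 3 A)))))
         (Mem 1 A))).

Lemma sat_Prefix e1 e2 A : sat e1 e2 (Prefix A) <-> prefix (e1 0) (e1 1).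
Proof.
rewrite /=; do !setoid_rewrite iff_imply; do !setoid_rewrite iff_succ.
rewrite /update /= eqxx; split=> [|/prefixP[u ->] B].
  (* The extensions of the first vertex form the least successor-closed set containing it. *)
  move/(_ [set w | prefix (e1 0) w]) => /=; apply; first exact: prefix_refl.
  by move=> v w /= vp [b ->]; apply: prefix_trans vp (prefix_rcons _ _).
elim/last_ind: u => [|u b IH] B0 BS; first by rewrite cats0.
by rewrite -rcons_cat; apply: (BS _ _ (IH B0 BS)); exists b.
Qed.

Definition Dense A D := Forall1 0 (Exists1 1 (And (Prefix A) (Mem 1 D))).

Lemma sat_Dense e1 e2 A D : D != A ->
  sat e1 e2 (Dense A D) <-> prefix_dense (e2 D).
Proof.
move=> DA; rewrite /Dense; have pP f f' := sat_Prefix f f' A.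
(* Abstracting the subformula stops simplification from unfolding it, so that [pP] can rewrite it
   under the binders. *)
move: (Prefix A) pP => p pP.
rewrite /=; do !setoid_rewrite iff_and; setoid_rewrite pP; rewrite /update /=.
by split=> H v; case: (H v) => w; [case|]; exists w.
Qed.

(** The root is singled out as the vertex that is nobody's child, and closure under prefixes is
    reduced to closure under parents. *)
Definition Path X :=
  let In S := Exists1 1 (And (S 0 1) (Mem 1 X)) in
  And (Exists1 0 (And (Mem 0 X) (Forall1 1 (Neg (Succ 1 0)))))
 (And (Forall1 0 (Forall1 1
        (Imp (Succ 0 1) (Imp (Mem 1 X) (Mem 0 X)))))
      (Forall1 0 (Imp (Mem 0 X)
        (Or (And (In SuccL) (Neg (In SuccR)))
            (And (Neg (In SuccL)) (In SuccR)))))).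

Lemma sat_Path e1 e2 X : sat e1 e2 (Path X) <-> is_path (e2 X).
Proof.
rewrite /= !iff_and.
do !setoid_rewrite iff_and; do !setoid_rewrite iff_imply; do !setoid_rewrite iff_succ.
rewrite /update /=.
have childE u : (exists w, w = u /\ e2 X w) <-> e2 X u.
  by split=> [[_ [->]]|] //; exists u.
split=> [[[r [Xr rroot]] [Xpre Xstep]]|[X0 Xpre Xstep]].
  split.
  - suff <- : r = [::] by [].
    by case/lastP: r rroot {Xr} => // r b /(_ r) []; exists b.
  - move=> v w /prefixP[u ->]; elim/last_ind: u => [|u b IH].
      by rewrite cats0.
    by rewrite -rcons_cat => /(Xpre _ _ (ex_intro _ b erefl)).
  - by move=> v /Xstep; rewrite /succL /succR !childE.
split; first by exists [::]; split=> // v [b /(congr1 size)]; rewrite size_rcons.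
split=> [v _ [b ->]|v /Xstep]; first by apply: Xpre; exact: prefix_rcons.
by rewrite /succL /succR !childE.
Qed.

Definition InfinitelyOften A X D :=
  Forall1 0 (Imp (Mem 0 X)
    (Exists1 1 (And (Prefix A) (And (Mem 1 X) (Mem 1 D))))).

Lemma sat_InfinitelyOften e1 e2 A X D :
  sat e1 e2 (InfinitelyOften A X D) <-> meets_infinitely_often (e2 X) (e2 D).
Proof.
rewrite /InfinitelyOften; have pP f f' := sat_Prefix f f' A.
move: (Prefix A) pP => p pP.
rewrite /=; do !setoid_rewrite iff_and; do !setoid_rewrite iff_imply.
setoid_rewrite pP; rewrite /update /=.
by split=> H v /H[w]; [case|]; exists w.
Qed.

(** [D] exceeds [X] and, by [free2_leq_code], every free set variable of [p]; [D.+1] serves as the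
    bound variable of [Prefix]. *)
Definition elim_star X p :=
  let D := (code p + X).+1 in
  Exists2 D (And (Dense D.+1 D)
    (Forall2 X (Imp (And (Path X) (InfinitelyOften D.+1 X D)) p))).

Lemma sat_elim_star e1 e2 X p :
  sat e1 e2 (elim_star X p) = sat e1 e2 (ForallStar X p).
Proof.
apply/propext; rewrite [X in _ <-> X]/= comeager_pathsP /elim_star.
set D := (code p + X).+1.
have DX : D != X by rewrite gtn_eqF // ltnS leq_addl.
have pD A B : sat e1 (update (update e2 D B) X A) p = sat e1 (update e2 X A) p.
  apply: sat_free2 => Z /free2_leq_code pZ; rewrite /update; case: eqP => // _.
  by rewrite ltn_eqF // ltnS (leq_trans pZ) // leq_addr.
have DS : D != D.+1 by rewrite ltn_eqF.
have dP B : sat e1 (update e2 D B) (Dense D.+1 D) <-> prefix_dense B.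
  by rewrite sat_Dense // update_eq.
have nP A B : sat e1 (update (update e2 D B) X A) (Path X) <-> is_path A.
  by rewrite sat_Path update_eq.
have iP A B : sat e1 (update (update e2 D B) X A) (InfinitelyOften D.+1 X D) <->
    meets_infinitely_often A B.
  by rewrite sat_InfinitelyOften update_eq update_neq // update_eq.
move: (Dense _ _) (Path X) (InfinitelyOften _ _ _) dP nP iP => d n i dP nP iP.
rewrite /=; do !setoid_rewrite iff_and; setoid_rewrite iff_imply.
setoid_rewrite dP; setoid_rewrite nP; setoid_rewrite iP.
split=> [[B [Bd H]]|[B Bd H]]; exists B => //.
  by move=> A Ap AB; split=> //; rewrite -(pD _ B); apply: H.
by split=> // A [Ap AB]; rewrite pD; have [] := H A Ap AB.
Qed.

Lemma free2_elim_star X p : {subset free2 (elim_star X p) <= [seq Z <- free2 p | Z != X]}.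
Proof.
move=> Z; rewrite /elim_star; set D := (_ + _).+1.
have DX : D != X by rewrite gtn_eqF // ltnS leq_addl.
by rewrite /= !eqxx /= DX /= !eqxx /= eqxx mem_filter => /andP[].
Qed.

(** * The translation of formulas *)

Fixpoint elim phi :=
  match phi with
  | Neg p => Neg (elim p)
  | Or p q => Or (elim p) (elim q)
  | Forall1 x p => Forall1 x (elim p)
  | Exists1 x p => Exists1 x (elim p)
  | Forall2 X p => Forall2 X (elim p)
  | Exists2 X p => Exists2 X (elim p)
  | ForallStar X p => elim_star X (elim p)
  | _ => phi
  end.

Lemma is_S2S_elim phi : is_S2S (elim phi).
Proof. by elim: phi => //= p -> q ->. Qed.

Lemma sat_elim e1 e2 phi : sat e1 e2 (elim phi) = sat e1 e2 phi.
Proof.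
elim: phi e1 e2 => [x y|x y|x X|p IH|p IHp q IHq|x p IH|x p IH|X p IH|X p IH|X p IH]
  e1 e2 //=.
- by rewrite IH.
- by rewrite IHp IHq.
- exact: eq_forall.
- exact: eq_exists.
- exact: eq_forall.
- exact: eq_exists.
- rewrite -[LHS]/(sat e1 e2 (elim_star X (elim p))) sat_elim_star /=.
  by congr comeager_paths; apply: eq_set => A; rewrite IH.
Qed.

Lemma free1_elim phi : free1 (elim phi) = free1 phi.
Proof. by elim: phi => //= [p -> q ->|x p ->|x p ->]. Qed.

Lemma free2_elim phi : {subset free2 (elim phi) <= free2 phi}.
Proof.
have sub_filter X (s t : seq nat) : {subset s <= t} ->
    {subset [seq Z <- s | Z != X] <= [seq Z <- t | Z != X]}.
  by move=> st Z; rewrite !mem_filter => /andP[-> /st].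
elim: phi => [x y|x y|x X|p IH|p IHp q IHq|x p IH|x p IH|X p IH|X p IH|X p IH] //=;
  try exact: sub_filter.
- by move=> Z; rewrite !mem_cat => /orP[/IHp|/IHq] ->; rewrite ?orbT.
- by move=> Z /free2_elim_star; exact: sub_filter.
Qed.

Lemma formula_in_elim xs Ys phi : formula_in xs Ys phi -> formula_in xs Ys (elim phi).
Proof.
rewrite /formula_in free1_elim => /and4P[-> -> -> /allP H] /=.
by apply/allP => Z /free2_elim; exact: H.
Qed.

Lemma defined_set_elim xs Ys phi :
  defined_set xs Ys (elim phi) = defined_set xs Ys phi.
Proof. by apply: eq_set => t; rewrite sat_elim. Qed.

(** * Effectiveness *)

Definition computable n (f : seq nat -> nat) : Prop :=
  exists c, forall xs, size xs = n -> eval c xs (f xs).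

Lemma eq_computable n f g :
  (forall xs, size xs = n -> f xs = g xs) -> computable n f -> computable n g.
Proof. by move=> fg [c cf]; exists c => xs xsn; rewrite -fg //; exact: cf. Qed.

(** The default [f] of [nth] is just an inhabitant of the right type and is never reached for
    [i < size gs]. *)
Lemma computable_comp n f (gs : seq (seq nat -> nat)) :
  computable (size gs) f -> (forall i, i < size gs -> computable n (nth f gs i)) ->
  computable n (fun xs => f [seq g xs | g <- gs]).
Proof.
move=> [c cf] gsn.
have [cs [scs csP]] : exists cs, size cs = size gs /\ forall xs, size xs = n ->
    forall i, i < size gs -> eval (nth MZero cs i) xs (nth f gs i xs).
  elim: gs gsn {cf} => [|g gs IH] gsn; first by exists [::].
  have [cg cgP] := gsn 0 isT.
  have [//|cs [scs csP]] := IH; first by move=> i ; exact: (gsn i.+1).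
  by exists (cg :: cs); split=> [|xs xsn [|i]] /=; [rewrite scs|move=> _; exact: cgP|exact: csP].
exists (MComp c cs) => xs xsn.
apply: (@eval_comp _ _ _ [seq g xs | g <- gs]); first by rewrite size_map scs.
  by move=> i; rewrite scs => igs; rewrite (nth_map f) //; exact: csP.
by apply: cf; rewrite size_map.
Qed.

(** Describing [h] by its recursion equations makes the lemma apply to any Rocq function that
    satisfies them; [g] receives the counter, the previous value and the parameters, as in
    [MRec]. *)
Lemma computable_rec n f g (h : seq nat -> nat) :
  computable n f -> computable n.+2 g ->
  (forall ys, h (0 :: ys) = f ys) ->
  (forall k ys, h (k.+1 :: ys) = g [:: k, h (k :: ys) & ys]) ->
  computable n.+1 h.
Proof.
move=> [cf cfP] [cg cgP] h0 hS; exists (MRec cf cg) => -[//|k ys] [ysn].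
elim: k => [|k IH]; first by rewrite h0; apply: eval_rec0; exact: cfP.
by rewrite hS; apply: eval_recS IH _; apply: cgP; rewrite /= ysn.
Qed.

Lemma computable_nth n i : i < n -> computable n (fun xs => nth 0 xs i).
Proof. by move=> ni; exists (MProj i) => xs xsn; apply: eval_proj; rewrite xsn. Qed.

Section composition.
Variables (n : nat) (a b c : seq nat -> nat).
Hypotheses (ca : computable n a) (cb : computable n b) (cc : computable n c).

Lemma computable_comp1 f :
  computable 1 (fun xs => f (nth 0 xs 0)) -> computable n (fun xs => f (a xs)).
Proof. by move=> /(@computable_comp n _ [:: a]); apply => -[]. Qed.

Lemma computable_comp2 f :
  computable 2 (fun xs => f (nth 0 xs 0) (nth 0 xs 1)) ->
  computable n (fun xs => f (a xs) (b xs)).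
Proof. by move=> /(@computable_comp n _ [:: a; b]); apply => -[|[]]. Qed.

Lemma computable_comp3 f :
  computable 3 (fun xs => f (nth 0 xs 0) (nth 0 xs 1) (nth 0 xs 2)) ->
  computable n (fun xs => f (a xs) (b xs) (c xs)).
Proof. by move=> /(@computable_comp n _ [:: a; b; c]); apply => -[|[|[]]]. Qed.

Lemma computable_succ : computable n (fun xs => (a xs).+1).
Proof.
by apply: computable_comp1; exists MSucc => -[|x xs] // _; exact: eval_succ.
Qed.

Lemma computable_const k : computable n (fun=> k).
Proof.
elim: k => [|k [ck ckP]]; first by exists MZero => xs _; exact: eval_zero.
exists (MComp MSucc [:: ck]) => xs xsn; apply: (@eval_comp _ _ _ [:: k]) => //.
  by case=> // _; exact: ckP.
exact: eval_succ.
Qed.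
End composition.

Lemma computable_pred n a : computable n a -> computable n (fun xs => (a xs).-1).
Proof.
move=> ca; apply: (computable_comp1 ca (f := predn)).
apply: (@computable_rec 0 (fun=> 0) (fun xs => nth 0 xs 0)) => //.
  exact: computable_const.
exact: computable_nth.
Qed.

Lemma computable_add n a b : computable n a -> computable n b ->
  computable n (fun xs => a xs + b xs).
Proof.
move=> ca cb; apply: (computable_comp2 ca cb (f := addn)).
apply: (@computable_rec 1 (fun xs => nth 0 xs 0) (fun xs => (nth 0 xs 1).+1)) => //.
  exact: computable_nth.
exact/computable_succ/computable_nth.
Qed.

Lemma computable_sub n a b : computable n a -> computable n b ->
  computable n (fun xs => a xs - b xs).
Proof.
(* Recursion runs on the first argument, so the subtrahend is moved there. *)
move=> ca cb; apply: (computable_comp2 cb ca (f := fun x y => y - x)).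
apply: (@computable_rec 1 (fun xs => nth 0 xs 0) (fun xs => (nth 0 xs 1).-1)).
- exact: computable_nth.
- exact/computable_pred/computable_nth.
- by move=> ys; rewrite /= subn0.
- by move=> k ys; rewrite /= subnS.
Qed.

Lemma computable_if0 n a b c : computable n a -> computable n b -> computable n c ->
  computable n (fun xs => if a xs == 0 then b xs else c xs).
Proof.
move=> ca cb cc.
apply: (computable_comp3 ca cb cc (f := fun x y z => if x == 0 then y else z)).
apply: (@computable_rec 2 (fun xs => nth 0 xs 0) (fun xs => nth 0 xs 3)) => //;
  exact: computable_nth.
Qed.

Lemma computable_if n a b c d : computable n a -> computable n b ->
  computable n c -> computable n d ->
  computable n (fun xs => if a xs == b xs then c xs else d xs).
Proof.
(* Two numbers are equal exactly when both truncated differences vanish. *)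
move=> ca cb cc cd; pose diff xs := (a xs - b xs) + (b xs - a xs).
apply: (@eq_computable _ (fun xs => if diff xs == 0 then c xs else d xs)).
  by move=> xs _; rewrite addn_eq0 !subn_eq0 -eqn_leq.
apply: computable_if0 => //.
by apply: computable_add; apply: computable_sub.
Qed.

Lemma computable_iter n f a b : computable 1 (fun xs => f (nth 0 xs 0)) ->
  computable n a -> computable n b ->
  computable n (fun xs => iter (a xs) f (b xs)).
Proof.
move=> cf ca cb; apply: (computable_comp2 ca cb (f := fun k x => iter k f x)).
apply: (@computable_rec 1 (fun xs => nth 0 xs 0) (fun xs => f (nth 0 xs 1))) => //.
  exact: computable_nth.
exact/computable_comp1/cf/computable_nth.
Qed.

(** * Cantor's pairing function and its inverse *)

Lemma computable_tri n a : computable n a -> computable n (fun xs => 'C((a xs).+1, 2)).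
Proof.
move=> ca; apply: (computable_comp1 ca (f := fun s => 'C(s.+1, 2))).
apply: (@computable_rec 0 (fun=> 0) (fun xs => nth 0 xs 1 + (nth 0 xs 0).+1)).
- exact: computable_const.
- by apply: computable_add; [|apply: computable_succ]; exact: computable_nth.
- by [].
- by move=> k ys; rewrite [nth _ _ _]/= binS bin1.
Qed.

Lemma computable_cpair n a b : computable n a -> computable n b ->
  computable n (fun xs => cpair (a xs) (b xs)).
Proof.
by move=> ca cb; apply: computable_add => //; exact/computable_tri/computable_add.
Qed.

(* The sum [x + y] of the components of [m = cpair x y]. *)
Fixpoint cdiag m :=
  if m is k.+1 then
    if 'C((cdiag k).+2, 2) - m == 0 then (cdiag k).+1 else cdiag k
  else 0.

Definition csnd m := m - 'C((cdiag m).+1, 2).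
Definition cfst m := cdiag m - csnd m.

(** The pairs with sum [s] are coded from the triangular number ['C(s.+1, 2)] up to just below
    ['C(s.+2, 2)]. One step of [m] crosses at most one such bound, and [cdiag] grows exactly when it
    does. *)
Lemma cdiag_bounds m : 'C((cdiag m).+1, 2) <= m < 'C((cdiag m).+2, 2).
Proof.
elim: m => //= m /andP[lo hi]; rewrite subn_eq0.
case: (leqP 'C((cdiag m).+2, 2)) => [le|lt]; last by rewrite lt (leq_trans lo).
by rewrite le /= binS bin1 addnS ltnS (leq_trans hi) // leq_addr.
Qed.

Lemma cdiag_cpair x y : cdiag (cpair x y) = x + y.
Proof.
have /andP[lo hi] := cdiag_bounds (cpair x y).
apply/eqP; rewrite eqn_leq; apply/andP; split; rewrite leqNgt; apply/negP => lt.
  have : 'C((x + y).+2, 2) <= cpair x y by apply: leq_trans lo; exact: leq_bin2l.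
  by rewrite binS bin1 leq_add2l ltnNge leq_addl.
suff : cpair x y < cpair x y by rewrite ltnn.
by apply: leq_trans hi _; apply: leq_trans (leq_addr _ _); exact: leq_bin2l.
Qed.

Lemma csnd_cpair x y : csnd (cpair x y) = y.
Proof. by rewrite /csnd cdiag_cpair addKn. Qed.

Lemma cfst_cpair x y : cfst (cpair x y) = x.
Proof. by rewrite /cfst csnd_cpair cdiag_cpair addnK. Qed.

Lemma computable_cdiag n a : computable n a -> computable n (fun xs => cdiag (a xs)).
Proof.
move=> ca; apply: (computable_comp1 ca).
apply: (@computable_rec 0 (fun=> 0) (fun xs =>
  if 'C((nth 0 xs 1).+2, 2) - (nth 0 xs 0).+1 == 0
  then (nth 0 xs 1).+1 else nth 0 xs 1)) => //.
  exact: computable_const.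
apply: computable_if0; [apply: computable_sub|apply: computable_succ|];
  [apply: computable_tri| |..]; [apply: computable_succ|..].
all: try apply: computable_succ; exact: computable_nth.
Qed.

Lemma computable_csnd n a : computable n a -> computable n (fun xs => csnd (a xs)).
Proof.
by move=> ca; apply: computable_sub => //; exact/computable_tri/computable_cdiag.
Qed.

Lemma computable_cfst n a : computable n a -> computable n (fun xs => cfst (a xs)).
Proof.
move=> ca; apply: computable_sub; first exact: computable_cdiag.
exact: computable_csnd.
Qed.

Ltac computability :=
  lazymatch goal with
  | |- computable _ (fun=> ?k) => exact: computable_const
  | |- computable _ (fun xs => nth 0 xs _) => exact: computable_nth
  | |- computable _ (fun xs => if _ == _ then _ else _) =>
      apply: computable_if; computability
  | |- computable _ (fun xs => cpair _ _) => apply: computable_cpair; computability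
  | |- computable _ (fun xs => cfst _) => apply: computable_cfst; computability
  | |- computable _ (fun xs => csnd _) => apply: computable_csnd; computability
  | |- computable _ (fun xs => _ + _) => apply: computable_add; computability
  | |- computable _ (fun xs => _ - _) => apply: computable_sub; computability
  | |- computable _ (fun xs => _.+1) => apply: computable_succ; computability
  | _ => idtac
  end.

(* Course-of-values recursion: [history step n] lists the values at
   [n - 1, ..., 0], and [step] reads earlier values off it with [recall]. *)
Section course_of_values.
Variable step : nat -> nat -> nat.

Fixpoint history n :=
  if n is k.+1 then cpair (step k (history k)) (history k) else 0.

Definition cov_rec n := step n (history n).

Definition recall n t k := cfst (iter (n - k.+1) csnd t).

(** The head of the history is the value at [n - 1], so the value at [k] lies under [n - k.+1]
    tails. *)
Lemma recall_history n k : k < n -> recall n (history n) k = cov_rec k.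
Proof.
rewrite /recall; elim: n => // n IH; rewrite ltnS leq_eqVlt => /predU1P[->|kn].
  by rewrite subnn /= cfst_cpair.
by rewrite subSn // iterSr /= csnd_cpair IH.
Qed.

Lemma computable_cov_rec n a :
  computable 2 (fun xs => step (nth 0 xs 0) (nth 0 xs 1)) ->
  computable n a -> computable n (fun xs => cov_rec (a xs)).
Proof.
move=> cstep ca; apply: computable_comp2 => //.
apply: (computable_comp1 ca).
apply: (@computable_rec 0 (fun=> 0) (fun xs =>
  cpair (step (nth 0 xs 0) (nth 0 xs 1)) (nth 0 xs 1))) => //.
  exact: computable_const.
by apply: computable_cpair; [apply: computable_comp2|]; computability.
Qed.
End course_of_values.

Lemma computable_recall n a b c : computable n a -> computable n b -> computable n c ->
  computable n (fun xs => recall (a xs) (b xs) (c xs)).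
Proof.
move=> ca cb cc; apply/computable_cfst/computable_iter => //; computability => //.
Qed.

(* The translation on Goedel numbers *)
(* Otherwise conversion checks between codes compute binomial coefficients. *)
Opaque cpair.

(* [code (elim_star X p)] as a function of [X] and [q = code p]. *)
Definition code_elim_star X q :=
  let D := (q + X).+1 in
  cpair 8 (cpair D (cpair 3 (cpair 4 (cpair (code (Neg (Dense D.+1 D))) (cpair 3
    (cpair 7 (cpair X (cpair 4 (cpair
      (code (Neg (And (Path X) (InfinitelyOften D.+1 X D)))) q))))))))).

(** The fresh variable is chosen from [code p], and [p] itself enters the code of the result only
    through [code p], so both sides are convertible. *)
Lemma code_elim_starE X p : code (elim_star X p) = code_elim_star X (code p).
Proof. reflexivity. Qed.

Lemma computable_elim_star n a b : computable n a -> computable n b ->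
  computable n (fun xs => code_elim_star (a xs) (b xs)).
Proof.
by move=> ca cb; rewrite /code_elim_star /=; computability.
Qed.

Definition code_elim_step n t :=
  let tag := cfst n in
  let r := csnd n in
  if tag == 3 then cpair 3 (recall n t r)
  else if tag == 4 then
    cpair 4 (cpair (recall n t (cfst r)) (recall n t (csnd r)))
  else if tag == 9 then code_elim_star (cfst r) (recall n t (csnd r))
  (* With tags 3 and 4 already treated, truncated subtraction selects the atoms, tags 0 to 2. The
     formulas left are the ordinary quantifiers, tags 5 to 8, which keep their variable. *)
  else if tag - 4 == 0 then n
  else cpair tag (cpair (cfst r) (recall n t (csnd r))).

Definition code_elim := cov_rec code_elim_step.

Lemma computable_code_elim_step :
  computable 2 (fun xs => code_elim_step (nth 0 xs 0) (nth 0 xs 1)).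
Proof.
rewrite /code_elim_step; computability;
  first [apply: computable_recall | apply: computable_elim_star]; computability.
by apply: computable_recall; computability.
Qed.

Lemma code_elimE phi : code_elim (code phi) = code (elim phi).
Proof.
have lt_r t x y : 0 < t -> y < cpair t (cpair x y).
  by move=> t0; apply: leq_ltn_trans (leq_cpairr x y) (ltn_cpairr _ t0).
have lt_l t x y : 0 < t -> x < cpair t (cpair x y).
  by move=> t0; apply: leq_ltn_trans (leq_cpairl x y) (ltn_cpairr _ t0).
have recallE n k : k < n -> recall n (history code_elim_step n) k = code_elim k.
  exact: recall_history.
(* In each case the pairing is decoded and the bounds above turn every recalled value into the
   translated code of a subformula. *)
elim: phi => [x y|x y|x X|p IH|p IHp q IHq|x p IH|x p IH|X p IH|X p IH|X p IH];
  rewrite /code_elim /cov_rec /code_elim_step [code _]/= !(cfst_cpair, csnd_cpair) /=;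
  rewrite ?recallE ?ltn_cpairr ?lt_r ?lt_l //.
- by rewrite IH.
- by rewrite IHp IHq.
- by rewrite IH.
- by rewrite IH.
- by rewrite IH.
- by rewrite IH.
- by rewrite IH -code_elim_starE.
Qed.

Lemma effective_elim : effective elim.
Proof.
have [c cP] := computable_cov_rec computable_code_elim_step
  (@computable_nth 1 0 isT).
by exists c => phi; rewrite -code_elimE; exact: cP.
Qed.

Theorem theorem8p2 :
  exists F : formula -> formula,
    effective F /\
    forall phi : formula,
      is_S2S (F phi) /\
      forall xs Ys : seq nat,
        formula_in xs Ys phi ->
        formula_in xs Ys (F phi) /\
        defined_set xs Ys (F phi) = defined_set xs Ys phi.
Proof.
exists elim; split; first exact: effective_elim.
move=> phi; split=> [|xs Ys phi_in]; first exact: is_S2S_elim.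
by split; [exact: formula_in_elim|exact: defined_set_elim].
Qed.
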